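(* Let $\{a_n\},\{b_n\},\{c_n\},\{d_n\}$ be sequences of real numbers with $1\le a_n\le b_n$ for all $n\in\mathbb{N}$, and let $\psi:\mathbb{N}\to[0,\infty)$. Let $$M(\psi)=\{x\in[0,1]:\ \|a_nx+c_n\|\cdot\|b_nx+d_n\|<\psi(n)\text{ for infinitely many }n\in\mathbb{N}\}.$$ Then $\dim_{\mathrm H}M(\psi)\le\min\{1,\tau\}$, where $$\tau=\inf\left\{s>0:\ \sum_{n\in\mathbb{N}}\left[b_n\left(\frac{\psi(n)}{b_n}\right)^s+a_n\left(\frac{\psi(n)}{a_nb_n}\right)^{s/2}\right]<\infty\right\}.$$
   Context: $\mathbb{N}$ is the set of positive integers. $\|x\|$ denotes the distance from $x\in\mathbb{R}$ to the nearest integer. $\dim_{\mathrm H}$ denotes Hausdorff dimension. *)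

(* Defs.v *)
From mathcomp Require Import all_boot all_order all_algebra.
From mathcomp Require Import all_classical all_reals all_analysis.
Set Implicit Arguments.
Unset Strict Implicit.
Unset Printing Implicit Defensive.
Import Order.TTheory GRing.Theory Num.Theory.
Import numFieldNormedType.Exports.

Local Open Scope classical_set_scope.
Local Open Scope ring_scope.

Section Hausdorff.
Context {R : realType}.
Implicit Types (U A : set R) (s delta : R).

(* diam set0 = -oo, so set0 is allowed in covers at every scale. *)
Definition diam U : \bar R :=
  ereal_sup [set (`|p.1 - p.2|)%:E | p in U `*` U].

(* diam U ^ s, with the conventions that set0 has weight 0 for every s and
   that a point has weight 0 `^ 0 = 1 for s = 0. *)
Definition diam_pow s U : \bar R :=
  if U == set0 then 0%E else poweR (diam U) s.

(* Covers are indexed by nat; finite covers are padded with set0. *)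
Definition delta_cover delta A : set (nat -> set R) :=
  [set F | A `<=` \bigcup_i F i /\ forall i, (diam (F i) <= delta%:E)%E].

Definition hausdorff_pre_measure s delta A : \bar R :=
  ereal_inf [set (\sum_(0 <= i <oo) diam_pow s (F i))%E
            | F in delta_cover delta A].

(* The supremum over delta > 0 is the limit as delta decreases to 0. *)
Definition hausdorff_measure s A : \bar R :=
  ereal_sup [set hausdorff_pre_measure s delta A
            | delta in [set delta | 0 < delta]].

Definition hausdorff_dim A : \bar R :=
  ereal_inf [set s%:E | s in [set s | 0 <= s /\ hausdorff_measure s A = 0%E]].

End Hausdorff.

Section MultiplicativeApproximation.
Context {R : realType}.
Implicit Types (a b c d psi : nat -> R).

Definition dist_int (x : R) : R :=
  inf [set `|x - m%:~R| | m in [set: int]].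

(* Sequences are indexed by the positive integers: values at n = 0 are never
   used. *)
Definition limsup_set a b c d psi : set R :=
  [set x | 0 <= x <= 1 /\
    infinite_set [set n : nat | (0 < n)%N /\
      dist_int (a n * x + c n) * dist_int (b n * x + d n) < psi n]].

(* inf set0 = +oo.  As s > 0, terms with psi n = 0 vanish since
   0 `^ s = 0 for s != 0. *)
Definition convergence_exponent a b psi : \bar R :=
  ereal_inf [set s%:E | s in [set s : R | 0 < s /\
    (\sum_(1 <= n <oo)
       (b n * (psi n / b n) `^ s
        + a n * (psi n / (a n * b n)) `^ (s / 2))%:E < +oo)%E]].

End MultiplicativeApproximation.

(* Main.v *)
(* Borel-Cantelli.  For fixed n, let y be the zero of [a x + c - k] nearest to x
   and let z be the zero of [b x + d - m] nearest to x, at rank i from y among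
   such zeros.  If |i| <= 1, then |x - y| |x - z| < psi / (a b) puts x within
   sqrt (psi / (a b)) of y or z.  If |i| >= 2, then |x - y| >= |i| / (4 b), hence
   |x - z| < 4 psi / (a |i|).  There are O(a) values of k and |i| is at most
   2 b / a; since s < 1, the sum of |i|^-s over this range is O((b / a)^(1 - s)),
   so the s-th powers of the diameters of these balls add up to a constant times
   the n-th term of the series.  For s >= 1 the bound dim <= 1 suffices. *)
Require Import Defs.
From mathcomp Require Import all_boot all_order all_algebra.
From mathcomp Require Import all_classical all_reals all_analysis.
From mathcomp Require Import zify ring lra.
Import Order.TTheory GRing.Theory Num.Theory.
Import numFieldNormedType.Exports.

Local Open Scope classical_set_scope.
Local Open Scope ring_scope.

(** * Null sets of Hausdorff measure from lists of balls *)

(** A pair is a centre and a radius; a negative radius encodes the empty set. *)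
Definition cball {R : realType} (p : R * R) : set R :=
  [set x | `|x - p.1| <= p.2].

Lemma diam_cball_le {R : realType} (p : R * R) (delta : R) :
  2 * p.2 <= delta -> (diam (cball p) <= delta%:E)%E.
Proof.
move=> pdelta; apply: ge_ereal_sup => _ [[x y] [/= xp yp] <-] /=.
rewrite lee_fin (le_trans _ pdelta)// mulr2n mulrDl !mul1r.
by rewrite (le_trans (ler_distD p.1 _ _))// lerD// distrC.
Qed.

Lemma diam_pow_ge0 {R : realType} (s : R) (U : set R) : (0 <= diam_pow s U)%E.
Proof. by rewrite /diam_pow; case: ifPn => // _; exact: poweR_ge0. Qed.

Lemma diam_pow_cball_le {R : realType} (s : R) (p : R * R) : 0 <= s ->
  (diam_pow s (cball p) <= ((2 * p.2) `^ s)%:E)%E.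
Proof.
move=> s0; rewrite /diam_pow; case: ifPn => [_|/set0P[x px]].
  by rewrite lee_fin powR_ge0.
have p0 : 0 <= p.2 by rewrite (le_trans _ px).
have d0 : (0 <= diam (cball p))%E.
  apply: ereal_sup_ubound; exists (x, x) => //=.
  by rewrite subrr normr0.
rewrite -poweR_EFin; apply: gt0_ler_poweR => //; first last.
- exact: diam_cball_le.
- by rewrite in_itv/= leey andbT lee_fin mulr_ge0.
- by rewrite in_itv/= leey andbT.
Qed.

(* No bound on the radii is required: a total weight below [delta `^ s] forces
   every diameter below [delta]. *)
Lemma hausdorff_measure_eq0 {R : realType} (s : R) (A : set R) : 0 < s ->
  (forall eps : R, 0 < eps -> exists L : nat -> seq (R * R),
    (forall x, A x -> exists n, exists2 p, p \in L n & cball p x) /\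
    (\sum_(0 <= n <oo) (\sum_(p <- L n) (2 * p.2) `^ s)%:E <= eps%:E)%E) ->
  hausdorff_measure s A = 0%E.
Proof.
move=> s0 cov; apply/eqP; rewrite eq_le; apply/andP; split; last first.
  apply: le_ereal_sup_tmp.
  exists (hausdorff_pre_measure s 1 A); first by exists 1 => //=; exact: ltr01.
  apply: le_ereal_inf_tmp => _ [F _ <-].
  by apply: nneseries_ge0 => n _ _; exact: diam_pow_ge0.
apply: ge_ereal_sup => _ [delta /= delta0 <-].
apply/lee_addgt0Pr => e e0; rewrite add0e.
have [L [AL Le]] : exists L : nat -> seq (R * R),
    (forall x, A x -> exists n, exists2 p, p \in L n & cball p x) /\
    (\sum_(0 <= n <oo) (\sum_(p <- L n) (2 * p.2) `^ s)%:E
       <= (Num.min e (delta `^ s))%:E)%E.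
  by apply: cov; rewrite lt_min e0 powR_gt0.
have weight0 n : (0 <= (\sum_(p <- L n) (2 * p.2) `^ s)%:E)%E.
  by rewrite lee_fin sumr_ge0// => p _; exact: powR_ge0.
have pL n p : p \in L n -> 2 * p.2 <= delta.
  move=> pLn; rewrite leNgt; apply/negP => deltap.
  have deltaLn : ((delta `^ s)%:E < (\sum_(p <- L n) (2 * p.2) `^ s)%:E)%E.
    rewrite lte_fin (perm_big _ (perm_to_rem pLn)) big_cons/=.
    rewrite (@lt_le_trans _ _ ((2 * p.2) `^ s))//.
      by apply: gt0_ltr_powR => //; rewrite nnegrE ltW// (lt_trans delta0).
    by rewrite lerDl sumr_ge0// => q _; exact: powR_ge0.
  suff : ((delta `^ s)%:E < (Num.min e (delta `^ s))%:E)%E.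
    by rewrite lte_fin lt_min ltxx andbF.
  apply: (lt_le_trans deltaLn); apply: le_trans Le.
  apply: (@le_trans _ _ (\sum_(0 <= i < n.+1) (\sum_(p <- L i) (2 * p.2) `^ s)%:E)%E).
    rewrite big_nat_recr//= leeDr// sume_ge0//.
  exact: nneseries_lim_ge.
(* A bijection of [nat] with [nat * nat] merges all the lists into one sequence of sets. Past the
   end of a list the default radius -1 gives [set0], of weight 0. *)
have /card_esym/ppcard_eqP[f] := card_nat2.
pose G (k : nat * nat) := cball (nth (0, -1) (L k.1) k.2).
have G0 n i : (size (L n) <= i)%N -> G (n, i) = set0.
  move=> ni; rewrite /G /= nth_default//; apply/seteqP; split => // x.
  by rewrite /cball /= => /(le_trans (normr_ge0 _)); rewrite ler0N1.
apply: (@le_trans _ _ (\sum_(0 <= i <oo) diam_pow s (G (f i)))%E).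
  apply: ereal_inf_lbound; exists (G \o f) => //; split.
    move=> x /AL[n [p pLn px]]; exists (f^-1%FUN (n, index p (L n))) => //=.
    by rewrite invK ?inE// /G /= nth_index.
  move=> i /=; apply: diam_cball_le.
  case: (f i) => n j /=; have [nj|nj] := leqP (size (L n)) j.
    by rewrite nth_default//= (le_trans _ (ltW delta0))// mulrN1 oppr_le0.
  exact/pL/mem_nth.
(* The sum along [f] becomes a double sum, over the list and the place in it; the inner sum stops at
   the length of the list. *)
rewrite -(esum_pred_image (diam_pow s \o G) f xpredT) => [||? ? _ _]; last 2 first.
- by move=> n _; exact: diam_pow_ge0.
- by apply: inj; rewrite inE.
rewrite (_ : f @` _ = setT `*`` (fun=> setT)); last first.
  apply/seteqP; split => // k _; exists (f^-1%FUN k) => //.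
  by rewrite invK ?inE.
rewrite -(@esum_esum _ _ _ setT (fun=> setT)
  (fun n i => diam_pow s (G (n, i)))); last first.
  by move=> *; exact: diam_pow_ge0.
rewrite -nneseries_esumT; last first.
  by move=> n; apply: esum_ge0 => i _; exact: diam_pow_ge0.
apply: (@le_trans _ _ (Num.min e (delta `^ s))%:E); last first.
  by rewrite lee_fin ge_min lexx.
apply: le_trans Le; apply: lee_nneseries => [n _ _|n _].
  by apply: esum_ge0 => i _; exact: diam_pow_ge0.
rewrite -nneseries_esumT; last by move=> i; exact: diam_pow_ge0.
rewrite (nneseries_split 0 (size (L n))); last first.
  by move=> i _; exact: diam_pow_ge0.
rewrite add0n eseries0 ?adde0; last first.
  by move=> i ni _; rewrite G0// /diam_pow eqxx.
rewrite (big_nth (0, -1)) -sumEFin; apply: lee_sum => i _.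
exact/diam_pow_cball_le/ltW.
Qed.

(** * The balls attached to a fixed [n] *)

(** The floor of [x + 1/2] lies within 1/2 of [x]; any other integer is at least 1 away from it,
    hence at least 1/2 away from [x]. *)
Lemma dist_int_nearest {R : realType} (x : R) :
  dist_int x = `|x - (Num.floor (x + 2^-1))%:~R|.
Proof.
set m := Num.floor _.
have /andP[mx xm] := floor_itv (x + 2^-1); rewrite -/m in mx xm.
apply/eqP; rewrite eq_le; apply/andP; split.
  apply: ge_inf; last by exists m.
  by exists 0 => _ [k _ <-].
apply: lb_le_inf; first by exists `|x - m%:~R|, m.
move=> _ [k _ <-]; have [->//|km] := eqVneq k m.
rewrite intrD in xm.
apply: (@le_trans _ _ 2^-1); first by rewrite ler_norml; lra.
rewrite ler_normr; apply/orP.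
have {km}[] : k%:~R + 1 <= m%:~R :> R \/ m%:~R + 1 <= k%:~R :> R.
  by move: km; rewrite neq_lt => /orP[km|mk]; [left|right];
    rewrite -(intrD _ _ 1) ler_int lezD1.
- by left; lra.
- by right; lra.
Qed.

(** Discrete form of the comparison with the integral of [t^-s]: by induction it suffices that
    [(1-s) (n+1)^-s <= (n+1)^(1-s) - n^(1-s)]. *)
Lemma sum_powRN_le {R : realType} (s : R) (n : nat) : 0 < s < 1 ->
  \sum_(1 <= j < n.+1) (j%:R : R) `^ (- s) <= n%:R `^ (1 - s) / (1 - s).
Proof.
move=> /andP[s0 s1]; have s1' : 0 < 1 - s by rewrite subr_gt0.
elim: n => [|n IHn].
  by rewrite big_geq// powR0 ?gt_eqF// mul0r.
rewrite big_nat_recr//= (le_trans (lerD IHn (lexx _)))//.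
rewrite ler_pdivlMr// mulrDl divfK ?gt_eqF//.
set x := n%:R; have x0 : 0 <= x by rewrite ler0n.
have -> : (n.+1%:R : R) = x + 1 by rewrite -natr1.
have x1 : 0 < x + 1 by rewrite ltr_pwDr.
(* Young's inequality gives x^(1-s) (x+1)^s <= (1-s) x + s (x+1). *)
have young : x `^ (1 - s) * (x + 1) `^ s <= x + s.
  have := @conjugate_powR _ (x `^ (1 - s)) ((x + 1) `^ s) (1 - s)^-1 s^-1.
  rewrite !invrK -!powRrM !divff ?gt_eqF// !powRr1 ?(ltW x1)//.
  rewrite !powR_ge0 !invr_gt0 subrK => /(_ isT isT s1' s0 erefl) /le_trans.
  by apply; rewrite le_eqVlt; apply/orP; left; apply/eqP; ring.
(* Multiplied by [(x+1)^s], the goal becomes [young]. *)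
rewrite -(ler_pM2r (powR_gt0 s x1)) mulrDl.
rewrite -[X in _ <= X]powRD ?subrK ?oner_eq0// powRr1 ?(ltW x1)//.
rewrite mulrAC -powRD ?addNr ?powRr0 ?mul1r; last by rewrite (gt_eqF x1) implybT.
lra.
Qed.

(* The points [y] run over the solutions of [a y + c = k], and the points
   [(q + i) / b] over the solutions of [b x + d = m] near [y]. *)
Definition ball_cover {R : realType} (a b c d psi : R) : seq (R * R) :=
  flatten [seq
    let y := ((Num.floor (c + 2^-1))%:~R + k%:R - c) / a in
    let q := (Num.floor (b * y + d))%:~R - d in
    let r := Num.sqrt (psi / (a * b)) in
    [:: (y, r), (q / b, r), ((q + 1) / b, r), ((q - 1) / b, r) &
      flatten [seq [:: ((q + j%:R) / b, 4 * psi / (a * j%:R));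
                       ((q - j%:R) / b, 4 * psi / (a * j%:R))]
              | j <- index_iota 1 (Num.truncn (2 * b / a)).+1]]
  | k <- index_iota 0 (Num.truncn a).+2].

Lemma ball_coverP {R : realType} (a b c d psi x : R) :
  1 <= a -> a <= b -> 0 <= x <= 1 ->
  dist_int (a * x + c) * dist_int (b * x + d) < psi ->
  exists2 p, p \in ball_cover a b c d psi & cball p x.
Proof.
move=> a1 ab /andP[x0 x1]; rewrite !dist_int_nearest.
have a0 : 0 < a by rewrite (lt_le_trans _ a1).
have b0 : 0 < b by rewrite (lt_le_trans _ ab).
set k := Num.floor (a * x + c + 2^-1); set m := Num.floor (b * x + d + 2^-1).
have /andP[kx xk] := floor_itv (a * x + c + 2^-1); rewrite -/k in kx xk.
have /andP[mx xm] := floor_itv (b * x + d + 2^-1); rewrite -/m in mx xm.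
set k0 := Num.floor (c + 2^-1).
have /andP[kc ck] := floor_itv (c + 2^-1); rewrite -/k0 in kc ck.
rewrite intrD in xk; rewrite intrD in xm; rewrite intrD in ck.
set u := a * x + c - k%:~R; set v := b * x + d - m%:~R => uv.
have hu : `|u| <= 2^-1 by rewrite ler_norml /u; lra.
have hv : `|v| <= 2^-1 by rewrite ler_norml /v; lra.
(* Since [0 <= a x <= a], the integer [k] satisfies [k0 <= k < k0 + a + 1], so its offset [k'] is in
   the range of the cover. *)
have ax0 : 0 <= a * x by rewrite mulr_ge0// ltW.
have axa : a * x <= a by rewrite ler_piMr// ltW.
have k0k : k0 <= k by apply: le_floor; lra.
have kE : k%:~R = k0%:~R + `|k - k0|%N%:R :> R.
  by rewrite pmulrn gez0_abs ?subr_ge0// -intrD subrKC.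
set k' := `|k - k0|%N in kE.
have k'lt : (k' < (Num.truncn a).+2)%N.
  rewrite -(ltr_nat R) -natr1; have := truncnS_gt a.
  by set t := _.+1%:R; lra.
set y : R := (k%:~R - c) / a.
set q : R := (Num.floor (b * y + d))%:~R - d.
set r := Num.sqrt (psi / (a * b)).
pose P (p : R * R) := p \in
    [:: (y, r), (q / b, r), ((q + 1) / b, r), ((q - 1) / b, r) &
      flatten [seq [:: ((q + j%:R) / b, 4 * psi / (a * j%:R));
                       ((q - j%:R) / b, 4 * psi / (a * j%:R))]
              | j <- index_iota 1 (Num.truncn (2 * b / a)).+1]].
suff [p Pp px] : exists2 p, P p & cball p x.
  exists p => //; apply/flattenP.
  eexists; last exact: Pp.
  apply/mapP; exists k'; first by rewrite mem_index_iota.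
  by rewrite /= -kE.
have xy : x - y = u / a by rewrite /y /u; field; rewrite gt_eqF.
pose w := b * y + d.
have /andP[fw wf] := floor_itv w; set f := Num.floor w in fw wf.
rewrite intrD in wf.
have fE : f%:~R = q + d by rewrite /q subrK.
have xm' : x - (q + (m - f)%:~R) / b = v / b.
  by rewrite /v intrB fE; field; rewrite gt_eqF.
(* The rank [i] equals [(b/a) u] up to an error of at most 3/2, because [|v| <= 1/2] and the
   fractional part of [w] is below 1. With [|u| <= 1/2] and [b/a >= 1] this gives [|i| <= 2 b/a]. *)
have mfE : (m - f)%:~R = b / a * u - v + (w - f%:~R).
  rewrite intrB /w /u /v /y; field; rewrite gt_eqF//.
set i := m - f in xm' mfE.
have ba1 : 1 <= b / a by rewrite ler_pdivlMr ?mul1r.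
have hbau : `|b / a * u| = b / a * `|u|.
  by rewrite normrM ger0_norm// (le_trans _ ba1).
set e := b / a in ba1 hbau mfE.
have bau2 : `|e * u| <= e / 2 by rewrite hbau ler_wpM2l// (le_trans _ ba1).
have ile : `|i%:~R : R| <= 2 * e.
  rewrite mfE ler_norml; move: bau2 hv; rewrite !ler_norml => /andP[? ?] /andP[? ?].
  lra.
have ilow : `|i%:~R : R| <= e * `|u| + 3 / 2.
  rewrite mfE -hbau (le_trans (ler_normD _ _))//.
  have : `|w - f%:~R| <= 1 by rewrite ler_norml; lra.
  have := ler_normB (e * u) v; lra.
have [i1|i2] := leqP `|i|%N 1.
  have [yr|yr] := leP `|x - y| r; first by exists (y, r) => //; rewrite /P inE eqxx.
  have [mr|mr] := leP `|x - (q + i%:~R) / b| r.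
    exists ((q + i%:~R) / b, r) => //; rewrite /P.
    have : [|| i == 0, i == 1 | i == -1] by clearbody i; clear -i1; lia.
    case/or3P => /eqP ->; rewrite !inE ?addr0 ?eqxx ?orbT//.
  (* If both distances exceed [r], then [r^2 a b <= |u| |v| < psi], whereas [r^2 a b = psi]. *)
  exfalso.
  have psi0 : 0 <= psi by rewrite (le_trans _ (ltW uv))// mulr_ge0.
  move: yr mr; rewrite xy xm' !normrM !normfV (gtr0_norm a0) (gtr0_norm b0).
  rewrite !ltr_pdivlMr// => yr mr.
  have : r * a * (r * b) < psi.
    rewrite (le_lt_trans _ uv)// ler_pM ?mulr_ge0 ?sqrtr_ge0// ltW//.
  rewrite (_ : _ * _ = r ^+ 2 * (a * b)); last by ring.
  rewrite sqr_sqrtr ?divr_ge0 ?mulr_ge0 ?(ltW a0) ?(ltW b0)//.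
  by rewrite divfK ?ltxx// mulf_neq0 ?gt_eqF.
have iE : `|i%:~R : R| = `|i|%N%:R by rewrite -intr_norm -abszE pmulrn.
set j := `|i|%N in i2 iE.
have ij : i = j%:Z \/ i = - j%:Z by rewrite /j; clearbody i; clear; lia.
have j0 : (0 < j%:R :> R) by rewrite ltr0n ltnW.
have j2 : (2 <= j%:R :> R) by rewrite ler_nat.
exists ((q + i%:~R) / b, 4 * psi / (a * j%:R)).
  rewrite /P !inE; do 4 (apply/orP; right); apply/flattenP.
  exists [:: ((q + j%:R) / b, 4 * psi / (a * j%:R));
             ((q - j%:R) / b, 4 * psi / (a * j%:R))].
    apply/mapP; exists j => //; rewrite mem_index_iota ltnS.
    apply/andP; split; first exact: ltnW.
    rewrite truncn_ge_nat -?iE; last by rewrite !mulr_ge0 ?invr_ge0 ?(ltW a0) ?(ltW b0).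
    by rewrite -mulrA.
  by case: ij => ->; rewrite !inE ?intrN ?pmulrn ?eqxx ?orbT.
rewrite /cball /= xm' normrM normfV (gtr0_norm b0).
(* As [j >= 2], the error 3/2 is at most [3 j / 4], so [j / 4 <= e |u|]; this is the 4 in the
   radius. *)
have jeu : j%:R <= 4 * (e * `|u|) by rewrite -iE in j2 *; lra.
rewrite ler_pdivrMr// mulrAC ler_pdivlMr ?mulr_gt0//.
have : `|v| * j%:R <= `|v| * (4 * (e * `|u|)) by rewrite ler_wpM2l.
have -> : `|v| * (4 * (e * `|u|)) = 4 * (`|u| * `|v|) * b / a.
  by rewrite /e; ring.
move=> H; rewrite mulrCA mulrC -ler_pdivlMr// (le_trans H)//.
by rewrite ler_pM2r ?invr_gt0// ler_pM2r// ler_pM2l// ltW.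
Qed.

(** At most [3 a] values of [k] occur: 12 is 3 times the four balls of radius
    [Num.sqrt (psi / (a * b))], and 6 is 3 times the two balls for each [j]. The factor [8^s] comes
    from the diameters [8 psi / (a j)], the rest from the power sum up to [2 b / a]. *)
Definition cover_const {R : realType} (s : R) : R :=
  12 * 2 `^ s + 6 * 8 `^ s * 2 `^ (1 - s) / (1 - s).

Lemma sum_ball_cover_le {R : realType} (s a b c d psi : R) : 0 < s < 1 ->
  1 <= a -> a <= b -> 0 <= psi ->
  \sum_(p <- ball_cover a b c d psi) (2 * p.2) `^ s <=
  cover_const s * (b * (psi / b) `^ s + a * (psi / (a * b)) `^ (s / 2)).
Proof.
move=> s01 a1 ab psi0; have /andP[s0 s1] := s01.
have a0 : 0 < a by rewrite (lt_le_trans _ a1).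
have b0 : 0 < b by rewrite (lt_le_trans _ ab).
have s1' : 0 < 1 - s by rewrite subr_gt0.
set T1 := b * _; set T2 := a * _.
have T10 : 0 <= T1 by rewrite mulr_ge0 ?powR_ge0// ltW.
have T20 : 0 <= T2 by rewrite mulr_ge0 ?powR_ge0// ltW.
(* For one [k], [A] is the weight of the four balls of equal radius and [B] bounds the weight of all
   the others. *)
pose A := 4 * 2 `^ s * (T2 / a).
pose B := 2 * 8 `^ s * 2 `^ (1 - s) / (1 - s) * (T1 / a).
have A0 : 0 <= A by rewrite !mulr_ge0 ?powR_ge0 ?invr_ge0// ltW.
have B0 : 0 <= B by rewrite !mulr_ge0 ?powR_ge0 ?invr_ge0// ltW.
have rE : (2 * Num.sqrt (psi / (a * b))) `^ s = 2 `^ s * (T2 / a).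
  rewrite powRM ?sqrtr_ge0// /T2 mulrAC divff ?gt_eqF// mul1r.
  rewrite -powR12_sqrt ?divr_ge0 ?mulr_ge0 ?(ltW a0) ?(ltW b0)//.
  by rewrite -powRrM [2^-1 * _]mulrC.
have psiE : (psi / a) `^ s * (b / a) `^ (1 - s) = T1 / a.
  rewrite /T1 (_ : psi / a = (psi / b) * (b / a)); last by field; rewrite !gt_eqF.
  have ba0 : 0 < b / a by rewrite divr_gt0.
  rewrite powRM ?divr_ge0 ?(ltW a0) ?(ltW b0)// -mulrA -powRD; last first.
    by rewrite (gt_eqF ba0) implybT.
  by rewrite subrKC powRr1 ?(ltW ba0)// mulrCA mulrA.
have sumB : \sum_(j <- index_iota 1 (Num.truncn (2 * b / a)).+1)
    2 * (2 * (4 * psi / (a * j%:R))) `^ s <= B.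
  rewrite (eq_big_nat _ _ (F2 := fun j =>
      2 * 8 `^ s * (psi / a) `^ s * j%:R `^ (- s))); last first.
    move=> j /andP[j1 _]; have j0 : (0 < j%:R :> R) by rewrite ltr0n.
    rewrite (_ : 2 * (_ / _) = 8 * ((psi / a) * j%:R^-1)); last first.
      by field; rewrite !gt_eqF.
    rewrite powRM ?mulr_ge0 ?invr_ge0 ?(ltW a0) ?(ltW j0)//.
    rewrite powRM ?mulr_ge0 ?invr_ge0 ?(ltW a0) ?(ltW j0)//.
    rewrite -(powR_inv1 (ltW j0)) -powRrM mulN1r; ring.
  rewrite -mulr_sumr /B -psiE.
  apply: (@le_trans _ _
    (2 * 8 `^ s * (psi / a) `^ s * ((2 * b / a) `^ (1 - s) / (1 - s)))).
    rewrite ler_wpM2l ?mulr_ge0 ?powR_ge0//.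
    rewrite (le_trans (sum_powRN_le _ _ s01))// ler_pM2r ?invr_gt0//.
    have ba0 : 0 <= 2 * b / a by rewrite !mulr_ge0 ?invr_ge0 ?(ltW a0) ?(ltW b0).
    by apply: ge0_ler_powR => //; rewrite ?nnegrE ?truncn_le// ltW.
  rewrite -[2 * b / a]mulrA [(2 * _) `^ _]powRM ?divr_ge0 ?(ltW a0) ?(ltW b0)//.
  by rewrite le_eqVlt; apply/orP; left; apply/eqP; ring.
rewrite big_flatten big_map.
apply: (@le_trans _ _ (\sum_(0 <= k < (Num.truncn a).+2) (A + B))).
  apply: ler_sum => k _.
  rewrite !big_cons big_flatten big_map/= rE.
  under eq_bigr do rewrite !big_cons big_nil addr0/= -mulr2n -[(_ `^ _) *+ _]mulr_natl.
  rewrite !addrA; apply: lerD => //; rewrite /A; lra.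
rewrite sumr_const_nat subn0 -mulr_natl.
(* The number of values of [k] is at most [a + 2 <= 3 a], by [1 <= a]. *)
apply: (@le_trans _ _ (3 * a * (A + B))).
  rewrite ler_wpM2r ?addr_ge0// -addn2 natrD.
  have := truncn_le a; rewrite (ltW a0); lra.
have -> : 3 * a * (A + B) = 12 * 2 `^ s * T2 +
    6 * 8 `^ s * 2 `^ (1 - s) / (1 - s) * T1.
  by rewrite /A /B; field; rewrite !gt_eqF.
have P0 : 0 <= 12 * 2 `^ s :> R by rewrite mulr_ge0 ?powR_ge0.
have Q0 : 0 <= 6 * 8 `^ s * 2 `^ (1 - s) / (1 - s).
  by rewrite !mulr_ge0 ?powR_ge0 ?invr_ge0// ltW.
(* The product of the two sums has these two terms and two nonnegative cross terms. *)
by rewrite /cover_const; nra.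
Qed.

(** * Borel-Cantelli and the dimension bounds *)

(** For every positive [N] the balls for [n >= N] cover the limsup set, and their weight is at most
    [cover_const s] times a tail of the convergent series. *)
Lemma limsup_set_hausdorff_measure0 {R : realType} (a b c d psi : nat -> R)
    (s : R) : 0 < s < 1 ->
  (forall n, (0 < n)%N -> 1 <= a n /\ a n <= b n) ->
  (forall n, (0 < n)%N -> 0 <= psi n) ->
  (\sum_(1 <= n <oo)
       (b n * (psi n / b n) `^ s
        + a n * (psi n / (a n * b n)) `^ (s / 2))%:E < +oo)%E ->
  hausdorff_measure s (limsup_set a b c d psi) = 0%E.
Proof.
move=> s01 hab hpsi.
set t := fun n => b n * (psi n / b n) `^ s + a n * (psi n / (a n * b n)) `^ (s / 2).
move=> tfin; have /andP[s0 s1] := s01.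
have t0 n : (0 < n)%N -> (0 <= (t n)%:E)%E.
  move=> /hab[a1 ab]; have a0 : 0 <= a n by rewrite (le_trans _ a1).
  by rewrite lee_fin addr_ge0// mulr_ge0 ?powR_ge0// (le_trans a0).
have C0 : 0 < cover_const s.
  rewrite addr_gt0 ?divr_gt0 ?mulr_gt0 ?powR_gt0 ?subr_gt0//.
apply: hausdorff_measure_eq0 => // eps eps0.
(* The terms are known to be nonnegative only for [0 < n], so the tails carry this condition. *)
have tail : (\sum_(N <= n <oo | (0 < n)%N) (t n)%:E)%E @[N --> \oo] --> 0%E.
  by apply: nneseries_tail_cvg => //; move: tfin; rewrite eseries_cond.
have [N N0 tN] : exists2 N, (0 < N)%N &
    (\sum_(N <= n <oo | (0 < n)%N) (t n)%:E <= (eps / cover_const s)%:E)%E.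
  have : \forall N \near \oo,
      (\sum_(N <= n <oo | (0 < n)%N) (t n)%:E < (eps / cover_const s)%:E)%E.
    apply: (tail [set y | (y < _)%E]); apply: open_ereal_lt'; rewrite lte_fin divr_gt0//.
  move=> [M _ HM]; exists M.+1 => //.
  by apply/ltW/HM => /=.
exists (fun n => if (N <= n)%N then ball_cover (a n) (b n) (c n) (d n) (psi n)
                 else [::]); split.
  move=> x [x01 xinf].
  have [n [n0 xn] Nn] : exists2 n, (0 < n)%N /\
      dist_int (a n * x + c n) * dist_int (b n * x + d n) < psi n & (N <= n)%N.
    (* Otherwise all solutions [n] lie below [N] and are finite in number. *)
    apply: contrapT => H; apply: xinf.
    apply: (@sub_finite_set _ _ `I_N); last exact: finite_II.
    move=> n /= xn; rewrite ltnNge; apply/negP => Nn; apply: H; by exists n.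
  exists n; rewrite Nn; have [a1 ab] := hab n n0.
  exact: ball_coverP.
apply: (@le_trans _ _ (\sum_(N <= n <oo | (0 < n)%N) (cover_const s)%:E * (t n)%:E)%E).
  rewrite [leRHS]eseries_cond [leRHS]eseries_mkcond; apply: lee_nneseries => n _.
    by move=> _; rewrite lee_fin sumr_ge0// => p _; exact: powR_ge0.
  case: (leqP N n) => [Nn|nN]; last by rewrite andbF big_nil.
  have n0 := leq_trans N0 Nn; have [a1 ab] := hab n n0.
  by rewrite n0 -EFinM lee_fin sum_ball_cover_le// hpsi.
rewrite nneseriesZl// (le_trans (lee_wpmul2l _ tN)) ?lee_fin ?(ltW C0)//.
by rewrite mulrC divfK ?gt_eqF.
Qed.

(** The [N + 1] balls of radius [1 / N] about the points [k / N] have weight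
    [(N + 1) (2 / N)^s <= 2 * 2^s / N^(s - 1)], which tends to 0 as [N] grows. *)
Lemma unit_interval_hausdorff_measure0 {R : realType} (s : R) (A : set R) :
  1 < s -> (forall x, A x -> 0 <= x <= 1) -> hausdorff_measure s A = 0%E.
Proof.
move=> s1 A01; have s0 : 0 < s by rewrite (lt_trans _ s1).
apply: hausdorff_measure_eq0 => // eps eps0.
pose K := 2 * 2 `^ s / eps.
have K0 : 0 < K by rewrite divr_gt0// mulr_gt0// powR_gt0.
(* Chosen so that [N^(s - 1) >= K], that is, [2 * 2^s / N^(s - 1) <= eps]. *)
pose N := (Num.truncn (K `^ (s - 1)^-1)).+1.
have N0 : 0 < N%:R :> R by rewrite ltr0n.
have KN : K <= N%:R `^ (s - 1).
  have -> : K = (K `^ (s - 1)^-1) `^ (s - 1).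
    by rewrite -powRrM mulVf ?powRr1 ?(ltW K0)// subr_eq0 gt_eqF.
  apply: ge0_ler_powR; rewrite ?nnegrE ?powR_ge0 ?ler0n//.
    by rewrite subr_ge0 ltW.
  by rewrite ltW// truncnS_gt.
have N1 : N.+1%:R <= 2 * N%:R :> R by rewrite -natrM ler_nat; lia.
clearbody N.
exists (fun n => if n is 0%N
                 then [seq (k%:R / N%:R, N%:R^-1) | k <- index_iota 0 N.+1]
                 else [::]); split.
  move=> x /A01/andP[x0 x1]; exists 0%N.
  have Nx0 : 0 <= N%:R * x by rewrite mulr_ge0 ?ler0n.
  have /andP[kx xk] := truncn_itv Nx0.
  exists ((Num.truncn (N%:R * x))%:R / N%:R, N%:R^-1).
    apply/mapP; exists (Num.truncn (N%:R * x)) => //.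
    rewrite mem_index_iota /= ltnS -(ler_nat R) (le_trans kx)//.
    by rewrite ler_piMr// ltW.
  rewrite /cball /=.
  have -> : x - (Num.truncn (N%:R * x))%:R / N%:R =
      (N%:R * x - (Num.truncn (N%:R * x))%:R) / N%:R.
    by field; rewrite gt_eqF.
  rewrite normrM normfV (gtr0_norm N0) ler_piMl ?invr_ge0 ?(ltW N0)//.
  by rewrite ler_norml; move: xk; rewrite -natr1; lra.
rewrite (nneseries_split 0 1); last first.
  by move=> n _; rewrite lee_fin sumr_ge0// => p _; exact: powR_ge0.
rewrite big_nat1 eseries0 ?adde0; last by case=> // n _ _; rewrite big_nil.
rewrite lee_fin big_map/= sumr_const_nat subn0 -[(_ `^ _) *+ _]mulr_natl.
rewrite (le_trans (ler_wpM2r (powR_ge0 _ _) N1))//.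
rewrite powRM ?invr_ge0 ?(ltW N0)//.
have -> : N%:R^-1 `^ s = N%:R^-1 * (N%:R `^ (s - 1))^-1 :> R.
  rewrite -(powR_inv1 (ltW N0)) -powRrM -powRN -powRD.
    by congr (_ `^ _); ring.
  by rewrite (gt_eqF N0) implybT.
have P0 : 0 < N%:R `^ (s - 1) :> R by rewrite powR_gt0.
rewrite [leLHS](_ : _ = 2 * 2 `^ s / N%:R `^ (s - 1)); last first.
  by field; rewrite !gt_eqF.
by rewrite ler_pdivrMr// [eps * _]mulrC -ler_pdivrMr.
Qed.

Lemma hausdorff_dim_le {R : realType} (s : R) (A : set R) : 0 <= s ->
  hausdorff_measure s A = 0%E -> (hausdorff_dim A <= s%:E)%E.
Proof. by move=> s0 As; apply: ereal_inf_lbound; exists s. Qed.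

Theorem theorem1p2 (R : realType) (a b c d psi : nat -> R)
    (hab : forall n : nat, (0 < n)%N -> 1 <= a n /\ a n <= b n)
    (hpsi : forall n : nat, (0 < n)%N -> 0 <= psi n) :
  (hausdorff_dim (limsup_set a b c d psi)
     <= Order.min 1%:E (convergence_exponent a b psi))%E.
Proof.
have dim1 : (hausdorff_dim (limsup_set a b c d psi) <= 1%:E)%E.
  (* The measure at exponent 1 may be positive, hence the exponents [1 + e]. *)
  apply/lee_addgt0Pr => e e0; rewrite -EFinD; apply: hausdorff_dim_le.
    by rewrite addr_ge0// ltW.
  apply: unit_interval_hausdorff_measure0; first by rewrite ltrDl.
  by move=> x [].
rewrite le_min dim1/=; apply: le_ereal_inf_tmp => _ [s [s0 sfin] <-].
have [s1|s1] := ltP s 1; last by rewrite (le_trans dim1)// lee_fin.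
apply: hausdorff_dim_le; first exact: ltW.
by apply: limsup_set_hausdorff_measure0 => //; rewrite s0.
Qed.
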